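(* For $N\ge1$ and integers $\Sigma_1,\Sigma_2\ge0$, $n\ge1$, let $a_N(\Sigma_1,\Sigma_2;n)$ be the number of partitions of $n$ with exactly $N$ positive parts, in which every part occurs at most twice, and whose alternating sum type (modulus $3$) is $(\Sigma_1,\Sigma_2)$. Let $A_0=1$, $A_N(x,y,q)=\sum_{\Sigma_1,\Sigma_2\ge0}\sum_{n\ge1}a_N(\Sigma_1,\Sigma_2;n)x^{\Sigma_1}y^{\Sigma_2}q^n$ for $N\ge1$, and $P_N(x,y,q)=\sum_{i=0}^{N}A_i(x,y,q)$. Then $$P_0=1,\qquad P_1=\frac{1}{1-xq},\qquad P_2=\frac{1}{(1-xq)(1-yq^2)},$$ and for all $N\ge1$, $$P_{3N}=P_{3N-1}\frac{1}{1-q^{3N}}-P_{3N-3}\frac{q^{3N}}{1-q^{3N}},$$ $$P_{3N+1}=P_{3N}\frac{1}{1-xq^{3N+1}}-P_{3N-2}\frac{xq^{3N+1}}{1-xq^{3N+1}},$$ $$P_{3N+2}=P_{3N+1}\frac{1}{1-yq^{3N+2}}-P_{3N-1}\frac{yq^{3N+2}}{1-yq^{3N+2}}.$$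
   Context: For a partition $\lambda_1\ge\dots\ge\lambda_r>0$, append zero parts so that its length becomes a multiple $3k$ of $3$. Its alternating sum type (modulus 3) is $(\Sigma_1,\Sigma_2)$ with $\Sigma_1=\sum_{i=1}^k(\lambda_{3i-2}-\lambda_{3i-1})$ and $\Sigma_2=\sum_{i=1}^k(\lambda_{3i-1}-\lambda_{3i})$. All series are formal power series (or convergent for $|x|,|y|,|q|<1$). *)

(* Defs.v *)
From HB Require Import structures.
From mathcomp Require Import all_boot all_order all_algebra.
From mathcomp Require Import boolp.

Set Implicit Arguments.
Unset Strict Implicit.
Unset Printing Implicit Defensive.

Import GRing.Theory.
Local Open Scope ring_scope.

(** * Formal power series in one variable *)

(* A record rather than a bare [nat -> R], which would carry the pointwise
   product of function spaces. *)
Record fps (R : Type) : Type := Fps { fcoef : nat -> R }.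

Lemma fpsP (R : Type) (f g : fps R) : fcoef f =1 fcoef g -> f = g.
Proof. by case: f g => [f] [g] /= /funext ->. Qed.

HB.instance Definition _ (R : Type) := gen_eqMixin (fps R).
HB.instance Definition _ (R : Type) := gen_choiceMixin (fps R).

Definition fps_zero (R : comNzRingType) : fps R := Fps (fun=> 0).
Definition fps_opp (R : comNzRingType) (f : fps R) : fps R :=
  Fps (fun n => - fcoef f n).
Definition fps_add (R : comNzRingType) (f g : fps R) : fps R :=
  Fps (fun n => fcoef f n + fcoef g n).

Lemma fps_addA (R : comNzRingType) : associative (@fps_add R).
Proof. by move=> f g h; apply: fpsP => n /=; rewrite addrA. Qed.
Lemma fps_addC (R : comNzRingType) : commutative (@fps_add R).
Proof. by move=> f g; apply: fpsP => n /=; rewrite addrC. Qed.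
Lemma fps_add0 (R : comNzRingType) : left_id (fps_zero R) (@fps_add R).
Proof. by move=> f; apply: fpsP => n /=; rewrite add0r. Qed.
Lemma fps_addN (R : comNzRingType) :
  left_inverse (fps_zero R) (@fps_opp R) (@fps_add R).
Proof. by move=> f; apply: fpsP => n /=; rewrite addNr. Qed.

HB.instance Definition _ (R : comNzRingType) := GRing.isZmodule.Build (fps R)
  (@fps_addA R) (@fps_addC R) (@fps_add0 R) (@fps_addN R).

Definition fpsC (R : comNzRingType) (c : R) : fps R :=
  Fps (fun n => if n == 0%N then c else 0).
Definition fpsX (R : comNzRingType) : fps R := Fps (fun n => (n == 1%N)%:R).
Definition fps_mul (R : comNzRingType) (f g : fps R) : fps R :=
  Fps (fun n => \sum_(i < n.+1) fcoef f i * fcoef g (n - i)).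

Definition fps_trunc (R : comNzRingType) (m : nat) (f : fps R) : {poly R} :=
  \poly_(i < m.+1) fcoef f i.

Lemma coef_trunc (R : comNzRingType) (m n : nat) (f : fps R) :
  (n <= m)%N -> (fps_trunc m f)`_n = fcoef f n.
Proof. by move=> le_nm; rewrite coef_poly ltnS le_nm. Qed.

Lemma coef_mul_trunc (R : comNzRingType) (m n : nat) (f g : fps R) :
  (n <= m)%N -> fcoef (fps_mul f g) n = (fps_trunc m f * fps_trunc m g)`_n.
Proof.
move=> le_nm; rewrite coefM; apply: eq_bigr => i _.
have le_in : (i <= n)%N by rewrite -ltnS.
by rewrite !coef_trunc ?(leq_trans _ le_nm) ?leq_subr.
Qed.

Lemma fps_mulC (R : comNzRingType) : commutative (@fps_mul R).
Proof.
by move=> f g; apply: fpsP => n; rewrite !(@coef_mul_trunc _ n) // mulrC.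
Qed.

Lemma fps_mulA (R : comNzRingType) : associative (@fps_mul R).
Proof.
move=> f g h; apply: fpsP => n.
transitivity ((fps_trunc n f * (fps_trunc n g * fps_trunc n h))`_n).
  rewrite coefM; apply: eq_bigr => i _.
  by rewrite coef_trunc -1?ltnS // -coef_mul_trunc ?leq_subr.
rewrite mulrA coefM; apply: eq_bigr => i _.
by rewrite -coef_mul_trunc -1?ltnS // coef_trunc ?leq_subr.
Qed.

Lemma fps_mul1 (R : comNzRingType) : left_id (fpsC (1 : R)) (@fps_mul R).
Proof.
move=> f; apply: fpsP => n /=.
by rewrite big_ord_recl /= mul1r subn0 big1 ?addr0 // => i _; rewrite mul0r.
Qed.

Lemma fps_mulDl (R : comNzRingType) :
  left_distributive (@fps_mul R) (@fps_add R).
Proof.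
move=> f g h; apply: fpsP => n /=.
by rewrite -big_split; apply: eq_bigr => i _; rewrite mulrDl.
Qed.

Lemma fps_oner_neq0 (R : comNzRingType) : fpsC (1 : R) != 0.
Proof.
apply/eqP => /(congr1 (fun f : fps R => fcoef f 0)) /= /eqP.
by rewrite oner_eq0.
Qed.

HB.instance Definition _ (R : comNzRingType) :=
  GRing.Zmodule_isComNzRing.Build (fps R) (@fps_mulA R) (@fps_mulC R)
    (@fps_mul1 R) (@fps_mulDl R) (@fps_oner_neq0 R).

(* A series is invertible iff its constant term is; the coefficients of the
   inverse are then given by the usual recursion. *)
Fixpoint fps_inv_seq (R : comUnitRingType) (f : fps R) (n : nat) : seq R :=
  if n is m.+1 then
    let s := fps_inv_seq f m in
    rcons s (if m == 0%N then (fcoef f 0)^-1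
             else - (fcoef f 0)^-1 * \sum_(i < m) s`_i * fcoef f (m - i))
  else [::].

Definition fps_unit (R : comUnitRingType) : {pred fps R} :=
  fun f => fcoef f 0 \is a GRing.unit.

Definition fps_inv (R : comUnitRingType) (f : fps R) : fps R :=
  if fps_unit f then Fps (fun n => (fps_inv_seq f n.+1)`_n) else f.

Lemma size_fps_inv_seq (R : comUnitRingType) (f : fps R) (n : nat) :
  size (fps_inv_seq f n) = n.
Proof. by elim: n => //= n IHn; rewrite size_rcons IHn. Qed.

Lemma nth_fps_inv_seq (R : comUnitRingType) (f : fps R) (n i : nat) :
  (i < n)%N -> (fps_inv_seq f n)`_i = (fps_inv_seq f i.+1)`_i.
Proof.
elim: n => // n IHn; rewrite ltnS leq_eqVlt => /predU1P[-> // | lt_in].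
by rewrite -IHn //= nth_rcons size_fps_inv_seq lt_in.
Qed.

Lemma fps_mulVx (R : comUnitRingType) :
  {in @fps_unit R, left_inverse 1 (@fps_inv R) *%R}.
Proof.
move=> f f_unit; apply: fpsP => n.
change (\sum_(i < n.+1) fcoef (fps_inv f) i * fcoef f (n - i)
          = fcoef (fpsC (1 : R)) n).
have /= f0_unit : fcoef f 0 \is a GRing.unit by [].
rewrite /fps_inv ifT // big_ord_recr /= subnn nth_rcons size_fps_inv_seq.
rewrite ltnn eqxx; case: n => [|n] /=; first by rewrite big_ord0 add0r mulVr.
rewrite -[in X in _ + X]mulrA [X in _ + _ * X]mulrC mulrA mulNr mulVr //.
rewrite mulN1r; apply/eqP; rewrite subr_eq0; apply/eqP/eq_bigr => i _.
by congr (_ * _); rewrite -(@nth_fps_inv_seq _ f n.+1).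
Qed.

Lemma fps_unitPl (R : comUnitRingType) (f g : fps R) :
  g * f = 1 -> fps_unit f.
Proof.
move=> /(congr1 (fun h : fps R => fcoef h 0)) /=.
rewrite big_ord1 subnn => gf1.
by apply/unitrPr; exists (fcoef g 0); rewrite mulrC.
Qed.

Lemma fps_invr_out (R : comUnitRingType) :
  {in [predC @fps_unit R], @fps_inv R =1 id}.
Proof. by move=> f /negPf f_nunit; rewrite /fps_inv ifF. Qed.

HB.instance Definition _ (R : comUnitRingType) :=
  GRing.ComNzRing_hasMulInverse.Build (fps R) (@fps_mulVx R) (@fps_unitPl R)
    (@fps_invr_out R).

Lemma fps_unitE (R : comUnitRingType) (f : fps R) :
  (f \is a GRing.unit) = (fcoef f 0 \is a GRing.unit).
Proof. by []. Qed.

(** * The ring Z[[x, y, q]], realised as Z[[x]][[y]][[q]] *)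

Definition fps3 : comUnitRingType := fps (fps (fps int)).

Definition varx : fps3 := fpsC (fpsC (fpsX int)).
Definition vary : fps3 := fpsC (fpsX (fps int)).
Definition varq : fps3 := fpsX (fps (fps int)).

Definition Fps3 (c : nat -> nat -> nat -> int) : fps3 :=
  Fps (fun n => Fps (fun b => Fps (fun a => c a b n))).
Definition coef3 (f : fps3) (a b n : nat) : int :=
  fcoef (fcoef (fcoef f n) b) a.

Lemma Fps3K (c : nat -> nat -> nat -> int) (a b n : nat) :
  coef3 (Fps3 c) a b n = c a b n.
Proof. by []. Qed.

Lemma fcoefXn (R : comNzRingType) (m n : nat) :
  fcoef (fpsX R ^+ m) n = (n == m)%:R.
Proof.
elim: m n => [|m IHm] n; first by rewrite expr0 /=; case: (n == 0%N).
rewrite exprS /=; case: n => [|n]; first by rewrite big_ord1 /= mul0r.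
rewrite 2!big_ord_recl /= mul0r add0r mul1r subSS subn0 IHm big1 ?addr0 //.
by move=> i _; rewrite mul0r.
Qed.

Lemma fpsCM (R : comNzRingType) (c d : R) : fpsC (c * d) = fpsC c * fpsC d.
Proof.
apply: fpsP => n /=; rewrite big_ord_recl /= subn0 big1 ?addr0.
  by case: (n == 0%N); rewrite ?mulr0.
by move=> i _; rewrite mul0r.
Qed.

Lemma fpsCXn (R : comNzRingType) (c : R) (m : nat) :
  fpsC (c ^+ m) = fpsC c ^+ m.
Proof. by elim: m => [|m IHm] //; rewrite !exprS fpsCM IHm. Qed.

Lemma fcoefCM (R : comNzRingType) (c : R) (f : fps R) (n : nat) :
  fcoef (fpsC c * f) n = c * fcoef f n.
Proof.
by rewrite /= big_ord_recl subn0 /= big1 ?addr0 // => i _; rewrite mul0r.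
Qed.

Lemma coef3_monomial (a b n a' b' n' : nat) :
  coef3 (varx ^+ a * vary ^+ b * varq ^+ n) a' b' n'
    = ((a' == a) && (b' == b) && (n' == n))%:R.
Proof.
rewrite /coef3 /varx /vary /varq -!fpsCXn -fpsCM fcoefCM fcoefXn.
case: (n' == n); last by rewrite mulr0 andbF.
rewrite mulr1 andbT fcoefCM fcoefXn; case: (b' == b).
  by rewrite mulr1 andbT fcoefXn.
by rewrite mulr0 andbF.
Qed.

(** * Partitions *)

Local Open Scope nat_scope.

Definition is_partition (n : nat) (l : seq nat) : bool :=
  [&& sorted geq l, 0 \notin l & sumn l == n].

(* With 0-based indexing, [nth 0 l (3 * i)], [nth 0 l (3 * i).+1] and
   [nth 0 l (3 * i).+2] are the parts number 3i+1, 3i+2 and 3i+3 of [l] padded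
   with zeros up to length [3 * nb_triples l].  The truncated subtractions are
   exact on nonincreasing sequences. *)
Definition nb_triples (l : seq nat) : nat := (size l + 2) %/ 3.

Definition alt_sum1 (l : seq nat) : nat :=
  \sum_(i < nb_triples l) (nth 0 l (3 * i) - nth 0 l (3 * i).+1).
Definition alt_sum2 (l : seq nat) : nat :=
  \sum_(i < nb_triples l) (nth 0 l (3 * i).+1 - nth 0 l (3 * i).+2).
Definition alt_sum_type (l : seq nat) : nat * nat := (alt_sum1 l, alt_sum2 l).

Definition at_most_twice (l : seq nat) : bool :=
  all (fun p => count_mem p l <= 2) l.

(* The parts of a partition of [n] are at most [n], so that its N-part
   partitions are all found among the N-tuples over 'I_n.+1 (see
   [partition_tuple]). *)
Definition nb_partitions (N s1 s2 n : nat) : nat :=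
  #|[set t : N.-tuple 'I_n.+1 |
      let l := map val t in
      [&& is_partition n l, at_most_twice l & alt_sum_type l == (s1, s2)]]|.

Lemma partition_tuple (N n : nat) (l : seq nat) :
  is_partition n l -> size l = N ->
  exists! t : N.-tuple 'I_n.+1, map val t = l.
Proof.
case/and3P=> _ _ /eqP sum_l sz_l.
have le_n p : p \in l -> p < n.+1.
  by move=> /rot_to[i s rot_l]; rewrite ltnS -sum_l -(perm_sumn (s1 := rot i l))
    ?perm_rot // rot_l leq_addr.
have sz_t : size (map (@inord n) l) == N by rewrite size_map sz_l.
have val_t : map val (map (@inord n) l) = l.
  rewrite -map_comp -[RHS]map_id; apply/eq_in_map => p /le_n lt_p.
  by rewrite /= inordK.
exists (Tuple sz_t); split=> // t' val_t'; apply/val_inj => /=.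
by apply: (inj_map val_inj); rewrite val_t val_t'.
Qed.

Local Open Scope ring_scope.

Definition gf_exact (N : nat) : fps3 :=
  if N == 0%N then 1
  else Fps3 (fun s1 s2 n =>
               if n == 0%N then 0 else (nb_partitions N s1 s2 n)%:Z).

Definition gf_upto (N : nat) : fps3 := \sum_(i < N.+1) gf_exact i.

(* Main.v *)
(* In a partition with exactly M positive parts, each occurring at most twice,
   subtract 1 from every part: what remains is a partition of the same kind with
   M, M - 1 or M - 2 positive parts, and the operation is a bijection.  It lowers
   the size by M, and lowers Sigma_1 (resp. Sigma_2) by 1 exactly when M = 1
   (resp. 2) mod 3, because the differences within a complete triple are
   unchanged.  Hence A_M = w_M (A_M + A_(M-1) + A_(M-2)) with w_M = q^M, x q^M,
   y q^M according to M mod 3.  As A_M = P_M - P_(M-1) and, for M >= 3, the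
   bracket is P_M - P_(M-3), solving for P_M gives the three recurrences. *)

Require Import Defs.
From mathcomp Require Import all_boot all_order all_algebra.
From mathcomp Require Import zify ring boolp.

Set Implicit Arguments.
Unset Strict Implicit.
Unset Printing Implicit Defensive.

Import GRing.Theory.
Local Open Scope ring_scope.

(** * Counting with duplicate-free lists of partitions *)

Definition counted_partition (N s1 s2 n : nat) (l : seq nat) : bool :=
  [&& size l == N, is_partition n l, at_most_twice l
    & alt_sum_type l == (s1, s2)].

(** Replaces the tuples over ['I_n.+1] by plain lists, on which the column bijection is defined;
    [partition_tuple] ensures that none is lost. *)
Lemma counted_partition_enum (N s1 s2 n : nat) :
  exists s : seq (seq nat),
    [/\ uniq s, s =i counted_partition N s1 s2 n
      & size s = nb_partitions N s1 s2 n].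
Proof.
rewrite /nb_partitions; set A := [set t | _].
exists [seq map val (tval t) | t <- enum A]; split.
- rewrite map_inj_uniq ?enum_uniq // => t u /(inj_map val_inj).
  exact: val_inj.
- move=> l; apply/mapP/idP => [[t]|].
    rewrite mem_enum inE => /and3P[tP t2 tS] ->.
    by rewrite unfold_in /counted_partition size_map size_tuple eqxx tP t2.
  case/and4P=> /eqP lN lP l2 lS.
  have [t [tl _]] := @partition_tuple N n l lP lN.
  by exists t => //; rewrite mem_enum inE /= tl; apply/and3P.
- by rewrite size_map -cardE.
Qed.

Lemma nb_partitions_size (N s1 s2 n : nat) (s : seq (seq nat)) :
  uniq s -> s =i counted_partition N s1 s2 n ->
  size s = nb_partitions N s1 s2 n.
Proof.
move=> s_uniq sE; have [t [t_uniq tE <-]] := counted_partition_enum N s1 s2 n.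
by apply/eqP; rewrite -(uniq_size_uniq t_uniq) // => l; rewrite sE tE.
Qed.

(** * Adding and removing the first column of a Young diagram *)

(** In terms of Young diagrams, a new first column of height [M] is put in front: the parts present
    grow by 1, and the padding zeros become parts 1. *)
Definition add_column (M : nat) (l : seq nat) : seq nat :=
  map S (l ++ nseq (M - size l) 0%N).

Definition remove_column (l : seq nat) : seq nat :=
  filter (ltn 0) (map predn l).

Lemma size_add_column (M : nat) (l : seq nat) :
  (size l <= M)%N -> size (add_column M l) = M.
Proof. by move=> lM; rewrite size_map size_cat size_nseq subnKC. Qed.

Lemma add_columnK (M : nat) (l : seq nat) :
  0%N \notin l -> remove_column (add_column M l) = l.
Proof.
move=> l0; rewrite /remove_column /add_column -map_comp map_id filter_cat.
rewrite filter_nseq cats0; apply/all_filterP/allP => p pl /=.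
by rewrite lt0n; apply: contraNneq l0 => <-.
Qed.

Lemma geq_trans : transitive geq.
Proof. exact: rev_trans leq_trans. Qed.

(** The zeros of a nonincreasing list form its tail, so erasing them and padding back to the old
    length loses nothing. *)
Lemma sorted_geq_filter_pos (l : seq nat) :
  sorted geq l ->
  l = filter (ltn 0) l ++ nseq (size l - size (filter (ltn 0) l)) 0%N.
Proof.
elim: l => //= p l IHl p_l.
have /IHl {}IHl := path_sorted p_l.
case: posnP p_l => [->|p_gt0] p_l /=; last by rewrite subSS -IHl.
have l0 : all (pred1 0%N) l.
  by apply/allP => r /(allP (order_path_min geq_trans p_l)); rewrite /= leqn0.
have -> : filter (ltn 0) l = [::].
  apply/eqP; rewrite -(negbK (_ == _)) -has_filter; apply/hasPn => r rl.
  by rewrite /= (eqP (allP l0 r rl)).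
by rewrite subn0 /=; congr (_ :: _); apply/all_pred1P.
Qed.

Lemma remove_columnK (l : seq nat) :
  sorted geq l -> 0%N \notin l -> add_column (size l) (remove_column l) = l.
Proof.
move=> l_sorted l0; rewrite /add_column /remove_column.
have pred_sorted : sorted geq (map predn l).
  rewrite sorted_map; apply: sub_sorted l_sorted => a b /=; lia.
rewrite -{1}(size_map predn) -sorted_geq_filter_pos // -map_comp.
rewrite -[RHS]map_id; apply/eq_in_map => p pl /=.
by rewrite prednK // lt0n; apply: contraNneq l0 => <-.
Qed.

Lemma remove_column_sorted (l : seq nat) :
  sorted geq l -> sorted geq (remove_column l).
Proof.
move=> l_sorted; apply: (sorted_filter geq_trans).
by rewrite sorted_map; apply: sub_sorted l_sorted => a b /=; lia.
Qed.

Lemma remove_column_pos (l : seq nat) : 0%N \notin remove_column l.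
Proof. by rewrite mem_filter. Qed.

Lemma size_remove_column (l : seq nat) : (size (remove_column l) <= size l)%N.
Proof. by rewrite size_filter (leq_trans (count_size _ _)) ?size_map. Qed.

Lemma add_column_pos (M : nat) (l : seq nat) : 0%N \notin add_column M l.
Proof. by apply/mapP => -[]. Qed.

Lemma add_column_sorted (M : nat) (l : seq nat) :
  sorted geq l -> sorted geq (add_column M l).
Proof.
move=> l_sorted; rewrite sorted_map.
have cat0 k : sorted geq (l ++ nseq k 0%N).
  rewrite (sorted_pairwise geq_trans) pairwise_cat.
  rewrite -!(sorted_pairwise geq_trans) l_sorted /=.
  apply/andP; split; first by apply/allrelP => a b _ /nseqP[-> _].
  by elim: k => //= -[|k].
by apply: sub_sorted (cat0 _) => a b.
Qed.

Lemma sumn_add_column (M : nat) (l : seq nat) :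
  (size l <= M)%N -> sumn (add_column M l) = (sumn l + M)%N.
Proof.
move=> lM; have sumS s : sumn (map S s) = (sumn s + size s)%N.
  by elim: s => //= p s ->; lia.
by rewrite sumS sumn_cat sumn_nseq size_cat size_nseq subnKC // addn0.
Qed.

Lemma at_most_twiceP (l : seq nat) :
  reflect (forall p, count_mem p l <= 2)%N (at_most_twice l).
Proof.
apply: (iffP allP) => [l2 p|l2 p _]; last exact: l2.
by case: (boolP (p \in l)) => [/l2 // | /count_memPn ->].
Qed.

Lemma count_add_column (M p : nat) (l : seq nat) :
  count_mem p.+1 (add_column M l)
    = (count_mem p l + (p == 0%N) * (M - size l))%N.
Proof.
rewrite count_map (eq_count (a2 := pred1 p)); last by move=> r /=; rewrite eqSS.
by rewrite count_cat count_nseq /= [_ == p]eq_sym.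
Qed.

(** Multiplicities of positive parts are carried from [p] to [p.+1]; the only new condition concerns
    the part 1, which comes exactly from the [M - size l] padding zeros. *)
Lemma at_most_twice_add_column (M : nat) (l : seq nat) :
  0%N \notin l ->
  at_most_twice (add_column M l) = at_most_twice l && (M <= size l + 2)%N.
Proof.
move=> l0; have c0 : count_mem 0%N l = 0%N by apply/count_memPn.
apply/at_most_twiceP/andP => [c2|[/at_most_twiceP l2 lM] [|p]].
- split; last by have := c2 1%N; rewrite count_add_column c0; lia.
  apply/at_most_twiceP => p; apply: leq_trans (c2 p.+1).
  by rewrite count_add_column leq_addr.
- by rewrite (count_memPn (add_column_pos M l)).
- rewrite count_add_column; case: eqP => [->|_]; first by rewrite c0; lia.
  by rewrite mul0n addn0.
Qed.

(** * Effect on the alternating sum type *)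

Lemma nth_add_column (M : nat) (l : seq nat) (i : nat) :
  (size l <= M)%N -> nth 0%N (add_column M l) i = ((i < M) + nth 0%N l i)%N.
Proof.
move=> lM; case: ltnP => [iM|Mi]; last first.
  by rewrite !nth_default // ?size_add_column // (leq_trans lM).
rewrite (nth_map 0%N) ?size_cat ?size_nseq ?subnKC // nth_cat nth_nseq.
by case: ltnP => [//|li]; rewrite if_same nth_default.
Qed.

Lemma nth_sorted_geq (l : seq nat) (i : nat) :
  sorted geq l -> (nth 0%N l i.+1 <= nth 0%N l i)%N.
Proof.
move=> l_sorted; case: (ltnP i.+1 (size l)) => [il|li].
  by have /(_ 0%N) := sortedP _ l_sorted; apply.
by rewrite nth_default.
Qed.

(** Terms beyond the last triple vanish. With [K = M], the sums for [l] and for [add_column M l] get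
    the same range and can be compared term by term. *)
Lemma alt_sum_widen (f : nat -> nat) (l : seq nat) (K : nat) :
  (size l <= K)%N ->
  (forall i, size l <= i -> f i = 0)%N ->
  (\sum_(i < nb_triples l) f (3 * i) = \sum_(i < K) f (3 * i))%N.
Proof.
move=> lK f0; have nbK : (nb_triples l <= K)%N by rewrite /nb_triples; lia.
rewrite -!(big_mkord xpredT (fun i => f (3 * i)%N)).
rewrite (big_cat_nat _ nbK) //= [X in (_ + X)%N]big_nat.
rewrite [X in (_ + X)%N]big1 ?addn0 // => i.
by move=> /andP[+ _]; rewrite /nb_triples => li; apply: f0; lia.
Qed.

Lemma alt_sum1_widen (l : seq nat) (K : nat) : (size l <= K)%N ->
  alt_sum1 l = (\sum_(i < K) (nth 0 l (3 * i) - nth 0 l (3 * i).+1))%N.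
Proof.
move=> lK; apply: (@alt_sum_widen (fun j => nth 0 l j - nth 0 l j.+1)%N) => //.
by move=> i li; rewrite nth_default.
Qed.

Lemma alt_sum2_widen (l : seq nat) (K : nat) : (size l <= K)%N ->
  alt_sum2 l = (\sum_(i < K) (nth 0 l (3 * i).+1 - nth 0 l (3 * i).+2))%N.
Proof.
move=> lK.
apply: (@alt_sum_widen (fun j => nth 0 l j.+1 - nth 0 l j.+2)%N) => //.
by move=> i li; rewrite nth_default // ltnW.
Qed.

(** Only the index [M %/ 3] can contribute, and it does so when the last triple is cut after [r]
    parts. *)
Lemma sum_residue (M r : nat) : (0 < r < 3)%N ->
  (\sum_(i < M) ((3 * i + r == M) : nat) = (M %% 3 == r))%N.
Proof.
move=> r3; case: eqP => [Mr|Mr]; last first.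
  by rewrite big1 // => i _; case: eqP => //; lia.
have iM : (M %/ 3 < M)%N by lia.
rewrite (bigD1 (Ordinal iM)) //= big1 => [|i]; first by case: eqP => //; lia.
by rewrite -val_eqE /= => /eqP; case: eqP => //; lia.
Qed.

(** The difference between entries [j] and [j.+1] grows by 1 if [j.+1 = M] and is otherwise
    unchanged; here [j] is [3 * i] for the first sum and [(3 * i).+1] for the second. *)
Lemma alt_sum_type_add_column (M : nat) (l : seq nat) :
  sorted geq l -> (size l <= M)%N ->
  alt_sum_type (add_column M l)
    = (alt_sum1 l + (M %% 3 == 1), alt_sum2 l + (M %% 3 == 2))%N.
Proof.
move=> l_sorted lM.
have szM : (size (add_column M l) <= M)%N by rewrite size_add_column.
rewrite /alt_sum_type; congr (_, _).
  rewrite !(@alt_sum1_widen _ M) // -sum_residue // -big_split /=.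
  apply: eq_bigr => i _; rewrite !nth_add_column //.
  (* Monotonicity makes the truncated subtraction exact. *)
  by have := @nth_sorted_geq l (3 * i) l_sorted; lia.
rewrite !(@alt_sum2_widen _ M) // -sum_residue // -big_split /=.
apply: eq_bigr => i _; rewrite !nth_add_column //.
by have := @nth_sorted_geq l (3 * i).+1 l_sorted; lia.
Qed.

(** * The recurrence for the counts *)

Lemma counted_partition_add_column (M s1 s2 n : nat) (l : seq nat) :
  sorted geq l -> 0%N \notin l -> (size l <= M)%N ->
  counted_partition M s1 s2 n (add_column M l)
    = [&& M <= size l + 2, at_most_twice l, sumn l + M == n,
          alt_sum1 l + (M %% 3 == 1) == s1
        & alt_sum2 l + (M %% 3 == 2) == s2]%N.
Proof.
move=> l_sorted l0 lM; rewrite /counted_partition /is_partition.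
rewrite size_add_column // add_column_sorted // add_column_pos.
rewrite sumn_add_column // at_most_twice_add_column //.
rewrite alt_sum_type_add_column // xpair_eqE eqxx /=.
by case: (M <= size l + 2)%N; rewrite ?andbT ?andbF //= andbCA.
Qed.

Lemma counted_partition_remove_column (M s1 s2 n : nat) (l : seq nat) :
  counted_partition M s1 s2 n l -> add_column M (remove_column l) = l.
Proof.
by case/and4P=> /eqP <- /and3P[l_sorted l0 _] _ _; apply: remove_columnK.
Qed.

(** [add_column M] maps the disjoint union of the lists for [M - 2], [M - 1] and [M] parts
    bijectively onto the partitions counted on the left. Shifting the arguments up on the left
    avoids truncated subtraction in them. *)
Lemma nb_partitions_rec (M s1 s2 n : nat) :
  (nb_partitions M (s1 + (M %% 3 == 1)) (s2 + (M %% 3 == 2)) (n + M)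
    = \sum_(M - 2 <= i < M.+1) nb_partitions i s1 s2 n)%N.
Proof.
have [E EP] := boolp.choice (fun i => counted_partition_enum i s1 s2 n).
pose s := [seq add_column M l | i <- index_iota (M - 2) M.+1, l <- E i].
rewrite -(@nb_partitions_size _ _ _ _ s).
- rewrite size_allpairs_dep sumnE big_map; apply: eq_bigr => i _.
  by have [_ _ ->] := EP i.
- apply: allpairs_uniq_dep; first exact: iota_uniq.
    by move=> i _; have [] := EP i.
  (* [remove_column] recovers the list, and the index of its block is its length. *)
  move=> u v /allpairsPdep[i [l [_ + ->]]] /allpairsPdep[j [m [_ + ->]]] /=.
  have [_ -> _] := EP i; have [_ -> _] := EP j.
  case/and4P=> /eqP <- /and3P[_ l0 _] _ _ /and4P[/eqP <- /and3P[_ m0 _] _ _].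
  by move/(congr1 remove_column); rewrite !add_columnK // => ->.
- move=> l; apply/allpairsPdep/idP => [[i [m [+ + ->]]]|].
    have [_ -> _] := EP i; rewrite mem_index_iota => iM.
    case/and4P=> /eqP m_i /and3P[m_sorted m0 /eqP m_n] m2.
    rewrite xpair_eqE => /andP[/eqP mS1 /eqP mS2].
    rewrite [_ \in _]counted_partition_add_column //; last by lia.
    by rewrite m2 m_n mS1 mS2 !eqxx /= andbT; lia.
  move=> l_counted; have lE := counted_partition_remove_column l_counted.
  have /and4P[/eqP l_M /and3P[l_sorted l0 _] _ _] := l_counted.
  move: l_counted; rewrite -lE [_ \in _]counted_partition_add_column //.
  + set m := remove_column l => /and5P[mM m2 m_n mS1 mS2].
    have szm : (size m <= M)%N by rewrite -l_M size_remove_column.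
    exists (size m), m; split=> //; first by rewrite mem_index_iota; lia.
    have [_ -> _] := EP (size m); rewrite unfold_in /=.
    rewrite /counted_partition /is_partition /alt_sum_type eqxx m2.
    rewrite remove_column_sorted // remove_column_pos xpair_eqE /=.
    by apply/and3P; split; lia.
  + exact: remove_column_sorted.
  + exact: remove_column_pos.
  + by rewrite -l_M size_remove_column.
Qed.

(** Covers the arguments not of the shifted form in [nb_partitions_rec]: every counted partition
    arises by adding a column, which already contributes these amounts. *)
Lemma nb_partitions_eq0 (M s1 s2 n : nat) :
  ~~ [&& (M %% 3 == 1) <= s1, (M %% 3 == 2) <= s2 & M <= n]%N ->
  nb_partitions M s1 s2 n = 0%N.
Proof.
move=> small; rewrite -(@nb_partitions_size _ _ _ _ [::]) // => l; symmetry.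
apply: contraNF small => l_counted.
have lE := counted_partition_remove_column l_counted.
have /and4P[/eqP l_M /and3P[l_sorted l0 _] _ _] := l_counted.
move: l_counted; rewrite -lE [_ \in _]counted_partition_add_column //.
- by case/and5P=> _ _ /eqP <- /eqP <- /eqP <-; rewrite !leq_addl.
- exact: remove_column_sorted.
- exact: remove_column_pos.
- by rewrite -l_M size_remove_column.
Qed.

(** * From counts to generating functions *)

Lemma fcoefXnM (R : comNzRingType) (m n : nat) (f : fps R) :
  fcoef (fpsX R ^+ m * f) n = if (m <= n)%N then fcoef f (n - m) else 0.
Proof.
change (\sum_(i < n.+1) fcoef (fpsX R ^+ m) i * fcoef f (n - i)
  = if (m <= n)%N then fcoef f (n - m) else 0).
case: leqP => [mn|nm].
  have m_lt : (m < n.+1)%N by [].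
  rewrite (bigD1 (Ordinal m_lt)) //= fcoefXn eqxx mul1r big1 ?addr0 // => i.
  by rewrite -val_eqE fcoefXn /= => /negPf ->; rewrite mul0r.
rewrite big1 // => i _; rewrite fcoefXn ltn_eqF ?mul0r //.
by apply: leq_trans nm; rewrite ltn_ord.
Qed.

Lemma fcoefCXnM (R : comNzRingType) (c : R) (m n : nat) (f : fps R) :
  fcoef (fpsC c * fpsX R ^+ m * f) n
    = if (m <= n)%N then c * fcoef f (n - m) else 0.
Proof. by rewrite -mulrA fcoefCM fcoefXnM; case: ifP; rewrite ?mulr0. Qed.

Lemma coef3_monomialM (a b n a' b' n' : nat) (f : fps3) :
  coef3 (varx ^+ a * vary ^+ b * varq ^+ n * f) a' b' n'
    = if [&& a <= a', b <= b' & n <= n']%N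
      then coef3 f (a' - a) (b' - b) (n' - n) else 0.
Proof.
rewrite /coef3 /varx /vary /varq -!fpsCXn -fpsCM fcoefCXnM.
case: (n <= n')%N; last by rewrite !andbF.
rewrite andbT fcoefCXnM; case: (b <= b')%N; last by rewrite andbF.
by rewrite andbT fcoefXnM.
Qed.

Lemma fps3P (f g : fps3) :
  (forall a b n, coef3 f a b n = coef3 g a b n) -> f = g.
Proof. by move=> fg; do 3![apply: fpsP => ?]; apply: fg. Qed.

Lemma coef3_sum (I : Type) (r : seq I) (F : I -> fps3) (a b n : nat) :
  coef3 (\sum_(i <- r) F i) a b n = \sum_(i <- r) coef3 (F i) a b n.
Proof. by apply: (big_morph (fun f : fps3 => coef3 f a b n)). Qed.

(** The two special cases in [gf_exact] agree with the count: the empty partition gives the series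
    1, and 0 has no partition into a positive number of parts. *)
Lemma coef3_gf_exact (N a b n : nat) :
  coef3 (gf_exact N) a b n = (nb_partitions N a b n)%:Z.
Proof.
rewrite /gf_exact; case: N => [|N] /=.
  rewrite -(@nb_partitions_size _ _ _ _
    (* The boolean serves as a length: the list holds the empty partition once if [a], [b] and [n]
       all vanish, and nothing otherwise. *)
    (nseq [&& a == 0, b == 0 & n == 0]%N [::])).
  - rewrite size_nseq /coef3 /=.
    by case: n => [|?]; case: b => [|?]; case: a => [|?].
  - by case: [&& _, _ & _].
  - move=> l; rewrite mem_nseq unfold_in /= /counted_partition size_eq0.
    case: (l =P [::]) => [->|_]; last by rewrite andbF.
    rewrite /is_partition /alt_sum_type /alt_sum1 /alt_sum2 /nb_triples /=.
    rewrite !big_ord0 xpair_eqE [0 == a]eq_sym [0 == b]eq_sym [0 == n]eq_sym.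
    by rewrite lt0b andbT; case: (a == _); case: (b == _); case: (n == _).
rewrite Fps3K; case: n => //; rewrite nb_partitions_eq0 //.
by rewrite ltn0 !andbF.
Qed.

(* Adding 1 to each of M parts turns the monomial of a partition into
   [column_weight M] times it: only the last triple can change its
   differences. *)
Definition column_weight (M : nat) : fps3 :=
  (if (M %% 3 == 1)%N then varx else if (M %% 3 == 2)%N then vary else 1)
    * varq ^+ M.

Lemma residue_monomial (R : pzSemiRingType) (x y : R) (r : nat) :
  (if (r == 1)%N then x else if (r == 2)%N then y else 1)
    = x ^+ (r == 1)%N * y ^+ (r == 2)%N.
Proof.
by case: r => [|[|[|r]]] /=; rewrite ?expr0 ?expr1 ?mulr1 ?mul1r.
Qed.

Lemma column_weightE (M : nat) :
  column_weight M = varx ^+ (M %% 3 == 1)%N * vary ^+ (M %% 3 == 2)%N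
                      * varq ^+ M.
Proof. by rewrite /column_weight residue_monomial. Qed.

Lemma column_weight_mod0 (M : nat) :
  (M %% 3 = 0)%N -> column_weight M = varq ^+ M.
Proof. by move=> M0; rewrite /column_weight M0; exact: mul1r. Qed.

Lemma column_weight_mod1 (M : nat) :
  (M %% 3 = 1)%N -> column_weight M = varx * varq ^+ M.
Proof. by move=> M1; rewrite /column_weight M1. Qed.

Lemma column_weight_mod2 (M : nat) :
  (M %% 3 = 2)%N -> column_weight M = vary * varq ^+ M.
Proof. by move=> M2; rewrite /column_weight M2. Qed.

(* [M - 2] is truncated, so M = 0, 1, 2 are covered too. *)
Lemma gf_exact_rec (M : nat) :
  gf_exact M = column_weight M * \sum_(M - 2 <= i < M.+1) gf_exact i.
Proof.
apply: fps3P => a b n; rewrite column_weightE coef3_monomialM coef3_gf_exact.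
case: ifPn => [/and3P[aM bM nM]|/nb_partitions_eq0 -> //].
rewrite coef3_sum -{1}(subnK aM) -{1}(subnK bM) -{1}(subnK nM).
rewrite nb_partitions_rec (big_morph Posz PoszD (erefl _)).
by apply: eq_bigr => i _; rewrite coef3_gf_exact.
Qed.

(** * Recurrences for the partial sums and their solution *)

Lemma gf_uptoS (M : nat) : gf_upto M.+1 = gf_upto M + gf_exact M.+1.
Proof. exact: big_ord_recr. Qed.

(** For one or two parts the sum in [gf_exact_rec] starts at 0, so it is the whole partial sum and
    nothing is subtracted. *)
Lemma gf_upto_rec_small (M : nat) :
  (M < 2)%N ->
  gf_upto M.+1 = gf_upto M + column_weight M.+1 * gf_upto M.+1.
Proof.
move=> M_lt2; rewrite {1}gf_uptoS {1}gf_exact_rec.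
have -> : (M.+1 - 2 = 0)%N by apply/eqP; rewrite subn_eq0.
by rewrite /gf_upto big_mkord.
Qed.

(** The three terms of index [M.+1] to [M.+3] are a difference of two partial sums. *)
Lemma gf_upto_rec (M : nat) :
  gf_upto M.+3 = gf_upto M.+2 + column_weight M.+3 * (gf_upto M.+3 - gf_upto M).
Proof.
rewrite {1}gf_uptoS {1}gf_exact_rec subn2 /=; congr (_ + _ * _).
have le_M : (M.+1 <= M.+4)%N by rewrite ltnS -addn3 leq_addr.
rewrite /gf_upto -!(big_mkord xpredT gf_exact).
by rewrite [in RHS](big_cat_nat _ le_M) // [RHS]addrC addKr.
Qed.

(** The constant term is 1 because [M] is positive. *)
Lemma fps_unit_subXn (R : comUnitRingType) (f : fps R) (M : nat) :
  (0 < M)%N -> 1 - f * fpsX R ^+ M \is a GRing.unit.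
Proof.
move=> M_gt0; rewrite fps_unitE mulrC.
change (1 - fcoef (fpsX R ^+ M * f) 0 \is a GRing.unit).
by rewrite fcoefXnM leqNgt M_gt0 subr0 unitr1.
Qed.

Lemma divr_fixpoint (R : comUnitRingType) (p p' w : R) :
  1 - w \is a GRing.unit -> p = p' + w * p -> p = p' / (1 - w).
Proof.
move=> w_unit pE; apply: (mulIr w_unit); rewrite divrK //.
by rewrite mulrBr mulr1 {1}pE [w * _]mulrC addrK.
Qed.

(** Moving [w * p] to the left gives [(1 - w) * p = p' - p'' * w]; this is [divr_fixpoint] with
    [p' - p'' * w] in place of [p']. *)
Lemma divr_linear_fixpoint (R : comUnitRingType) (p p' p'' w : R) :
  1 - w \is a GRing.unit -> p = p' + w * (p - p'') ->
  p = p' * (1 / (1 - w)) - p'' * (w / (1 - w)).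
Proof.
move=> w_unit pE; rewrite mul1r mulrA -mulrBl; apply: divr_fixpoint => //.
by rewrite {1}pE; ring.
Qed.

Lemma divrMr_unit (R : comUnitRingType) (p u v : R) :
  u \is a GRing.unit -> v \is a GRing.unit -> p / (u * v) = p / u / v.
Proof. by move=> u_unit v_unit; rewrite invrM // mulrCA mulrC mulrAC. Qed.

Lemma gf_upto_0 : gf_upto 0 = 1.
Proof. by rewrite /gf_upto big_ord1. Qed.

Lemma gf_upto_1 : gf_upto 1 = 1 / (1 - varx * varq).
Proof.
rewrite -[varq]expr1; apply: divr_fixpoint; first exact: fps_unit_subXn.
by rewrite -column_weight_mod1 // -gf_upto_0; apply: gf_upto_rec_small.
Qed.

Lemma gf_upto_2 :
  gf_upto 2 = 1 / ((1 - varx * varq) * (1 - vary * varq ^+ 2)).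
Proof.
have w1_unit : 1 - varx * varq \is a GRing.unit.
  by rewrite -[varq]expr1; apply: fps_unit_subXn.
have w2_unit : 1 - vary * varq ^+ 2 \is a GRing.unit.
  exact: fps_unit_subXn.
rewrite (divrMr_unit _ w1_unit w2_unit) -gf_upto_1.
apply: divr_fixpoint => //.
by rewrite -column_weight_mod2 //; apply: gf_upto_rec_small.
Qed.

Theorem theorem4p3 :
  [/\ gf_upto 0 = 1,
      gf_upto 1 = 1 / (1 - varx * varq),
      gf_upto 2 = 1 / ((1 - varx * varq) * (1 - vary * varq ^+ 2)) &
      forall N : nat, (1 <= N)%N ->
      [/\ gf_upto (3 * N)
            = gf_upto (3 * N - 1) * (1 / (1 - varq ^+ (3 * N)))
              - gf_upto (3 * N - 3)
                * (varq ^+ (3 * N) / (1 - varq ^+ (3 * N))),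
          gf_upto (3 * N + 1)
            = gf_upto (3 * N) * (1 / (1 - varx * varq ^+ (3 * N + 1)))
              - gf_upto (3 * N - 2)
                * (varx * varq ^+ (3 * N + 1)
                   / (1 - varx * varq ^+ (3 * N + 1))) &
          gf_upto (3 * N + 2)
            = gf_upto (3 * N + 1) * (1 / (1 - vary * varq ^+ (3 * N + 2)))
              - gf_upto (3 * N - 1)
                * (vary * varq ^+ (3 * N + 2)
                   / (1 - vary * varq ^+ (3 * N + 2)))]].

Proof.
split; [exact: gf_upto_0|exact: gf_upto_1|exact: gf_upto_2|case=> // N _].
(* After the shift of [N] to [N.+1], every index becomes an iterated successor of [3 * N], the form
   required by [gf_upto_rec]. *)
have -> : (3 * N.+1 - 1 = (3 * N).+2)%N by lia.
have -> : (3 * N.+1 - 2 = (3 * N).+1)%N by lia.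
have -> : (3 * N.+1 - 3 = 3 * N)%N by lia.
have -> : (3 * N.+1 = (3 * N).+3)%N by lia.
rewrite addn1 addn2.
split; apply: divr_linear_fixpoint.
(* In residue 0 the weight is a bare power of [varq], so a factor 1 is inserted. *)
- by rewrite -[varq ^+ _]mul1r fps_unit_subXn.
- by rewrite -column_weight_mod0; [exact: gf_upto_rec | lia].
- exact: fps_unit_subXn.
- by rewrite -column_weight_mod1; [exact: gf_upto_rec | lia].
- exact: fps_unit_subXn.
- by rewrite -column_weight_mod2; [exact: gf_upto_rec | lia].
Qed.
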